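(* Consider a covering mixed integer linear program $(\mathrm{C})$, let $\mathcal{I}=\{I_1,\dots,I_p\}$ be a partition of the index set $[m]$ of the rows of $A$, and let $G=G^{\mathrm{cover}}_{A,\mathcal{I}}=(V,E)$ be the covering interaction graph of $A$. Then for any sparse cut support list $\mathcal{V}\subseteq2^V$, $$z^{\mathcal{V},C}\ge\frac{1}{\bar\eta^{\mathcal{V}}(G)}\cdot z^I .$$
   Context: $[n]=\{1,\dots,n\}$. The covering problem $(\mathrm{C})$ is: minimize $c^Tx$ subject to $Ax\ge b$, $x_j\in\mathbb{Z}_+$ for $j\in\mathcal{L}$, $x_j\in\mathbb{R}_+$ for $j\in[n]\setminus\mathcal{L}$, where $A\in\mathbb{Q}_+^{m\times n}$, $b\in\mathbb{Q}_+^m$, $c\in\mathbb{Q}_+^n$, $\mathcal{L}\subseteq[n]$. Let $P$ be its feasible region, $P^I$ the convex hull of $P$, and $P^{LP}$ the feasible region of its linear programming relaxation. Sparse closures: for $N\subseteq[n]$, a sparse cut on $N$ is an inequality $\alpha^Tx\le\beta$ (any signs) valid for $P^I$ with $\alpha_i=0$ for all $i\notin N$; $P^{(N)}$ is the set of points of $P^{LP}$ satisfying all sparse cuts on $N$. Write $A_r$ for the $r$-th row of $A$ and $\mathrm{supp}(A_r)=\{j\in[n]:A_{rj}\ne0\}$. The covering interaction graph $G^{\mathrm{cover}}_{A,\mathcal{I}}$ has one node $v_i$ for each block $I_i\in\mathcal{I}$, and distinct nodes $v_i,v_j$ are adjacent iff $\bigcup_{r\in I_i}\mathrm{supp}(A_r)$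 intersects $\bigcup_{r\in I_j}\mathrm{supp}(A_r)$. For $S\subseteq V$ put $P^{(S)}:=P^{(N_S)}$ with $N_S=\bigcup_{v_i\in S}\bigcup_{r\in I_i}\mathrm{supp}(A_r)$. For a collection $\mathcal{V}$ of subsets of $V$ (the row support list), $P^{\mathcal{V},C}:=\bigcap_{S\in\mathcal{V}}P^{(S)}$. Set $z^I=\min\{c^Tx:x\in P^I\}$ and $z^{\mathcal{V},C}=\min\{c^Tx:x\in P^{\mathcal{V},C}\}$. Mixed stable sets: for a simple graph $G=(V,E)$ and a collection $\mathcal{V}$ of subsets of $V$, a collection $\mathcal{M}\subseteq 2^V$ is a mixed stable set subordinate to $\mathcal{V}$ if (1) every set in $\mathcal{M}$ is contained in some set of $\mathcal{V}$; (2) the sets in $\mathcal{M}$ are pairwise disjoint; (3) no edge of $G$ has endpoints in distinct sets of $\mathcal{M}$. The mixed chromatic number $\bar\eta^{\mathcal{V}}(G)$ is the smallest number $k$ of mixed stable sets $\mathcal{M}^1,\dots,\mathcal{M}^k$ subordinate to $\mathcal{V}$ that cover all vertices, i.e. every $v\in V$ belongs to a set in one of the $\mathcal{M}^i$. (If no such cover exists the stated bound is regarded as vacuous.) *)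

(* Defs.v *)
From HB Require Import structures.
From mathcomp Require Import all_boot all_order all_algebra.
From mathcomp Require Import all_classical all_reals all_analysis.

Set Implicit Arguments.
Unset Strict Implicit.
Unset Printing Implicit Defensive.

Import Order.TTheory GRing.Theory Num.Theory.

Local Open Scope ring_scope.

(* Several finset names (trivIset, cover, partition) are shadowed by
   classical_sets, hence the explicit qualification. *)

(* A collection of vertex sets is a {set {set V}}; a graph is its adjacency
   relation. *)
Section MixedStableSets.
Variables (V : finType) (e : rel V) (VV : {set {set V}}).

Definition mixed_stable (M : {set {set V}}) : bool :=
  [&& [forall X in M, exists S in VV, X \subset S],
      finset.trivIset M
    & [forall X in M, forall Y in M, (X != Y) ==>
         [forall u in X, forall v in Y, ~~ e u v]]].

Definition has_mixed_stable_cover (k : nat) : bool :=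
  [exists M : {ffun 'I_k -> {set {set V}}},
     [forall i, mixed_stable (M i)] &&
     [forall v, exists i, exists X in M i, v \in X]].

Definition mixed_chromatic_number
    (hcov : exists k, has_mixed_stable_cover k) : nat :=
  ex_minn hcov.

End MixedStableSets.

Section CoveringInteractionGraph.
Variables (m n p : nat) (A : 'M[rat]_(m, n)) (I : 'I_p -> {set 'I_m}).

Definition row_supp (r : 'I_m) : {set 'I_n} := [set j | A r j != 0].

Definition block_supp (i : 'I_p) : {set 'I_n} :=
  (\bigcup_(r in I i) row_supp r)%SET.

(* Node v_i is represented by the index i of the block I_i. *)
Definition cover_graph : rel 'I_p :=
  fun i j => (i != j) && ~~ [disjoint block_supp i & block_supp j].

Lemma cover_graph_sym : symmetric cover_graph.
Proof. by move=> i j; rewrite /cover_graph eq_sym disjoint_sym. Qed.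

Lemma cover_graph_irr : irreflexive cover_graph.
Proof. by move=> i; rewrite /cover_graph eqxx. Qed.

Definition node_supp (S : {set 'I_p}) : {set 'I_n} :=
  (\bigcup_(i in S) block_supp i)%SET.

End CoveringInteractionGraph.

Local Open Scope classical_set_scope.

Section Feasible.
Variables (R : realType) (m n : nat).
Variables (A : 'M[rat]_(m, n)) (b : 'cV[rat]_m) (L : {set 'I_n}).

Definition dot (a x : 'cV[R]_n) : R := (a^T *m x) 0 0.

Definition lp_region : set 'cV[R]_n :=
  [set x | (forall r, (map_mx ratr A *m x) r 0 >= ratr (b r 0)) /\
           (forall j, x j 0 >= 0)].

Definition mip_region : set 'cV[R]_n :=
  [set x | lp_region x /\ (forall j, j \in L -> x j 0 \is a Num.nat)].

Definition mip_hull : set 'cV[R]_n :=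
  smallest (@convex_set R 'cV[R]_n) mip_region.

Definition sparse_cut (N : {set 'I_n}) (alpha : 'cV[R]_n) (beta : R) : Prop :=
  (forall x, mip_hull x -> dot alpha x <= beta) /\
  (forall j, j \notin N -> alpha j 0 = 0).

Definition sparse_closure (N : {set 'I_n}) : set 'cV[R]_n :=
  [set x | lp_region x /\
     forall alpha beta, sparse_cut N alpha beta -> dot alpha x <= beta].

(* Every sparse closure lies in lp_region, so intersecting with lp_region
   only matters when VV is empty: the empty intersection is lp_region. *)
Definition support_list_closure (p : nat) (I : 'I_p -> {set 'I_m})
    (VV : {set {set 'I_p}}) : set 'cV[R]_n :=
  lp_region `&`
  \bigcap_(S in [set` VV]) sparse_closure (node_supp A I S).

(* Optimal value of minimizing c^T x over D, with value +oo when D is empty. *)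
Definition opt_value (c : 'cV[rat]_n) (D : set 'cV[R]_n) : \bar R :=
  ereal_inf [set (dot (map_mx ratr c) x)%:E | x in D].

End Feasible.

Arguments lp_region R {m n} A b.
Arguments mip_region R {m n} A b L.
Arguments mip_hull R {m n} A b L.
Arguments sparse_closure R {m n} A b L N.
Arguments support_list_closure R {m n} A b L {p} I VV.

(* Main.v *)
(** Fix a point x of the sparse closure, a mixed stable cover M^1, ..., M^k and
    e > 0.  For a vertex set X of some M^i, let N_X be the set of columns met by
    the rows of X.  As "the part of the cost on N_X is at least t" is a sparse
    cut as soon as it is valid on P, some y^X in P has cost on N_X at most the
    cost of x on N_X plus e.  Add up the restrictions of all y^X to N_X.  Every
    row is supported in some N_X and A >= 0, so the sum z lies in P.  Within
    one M^i the sets N_X are disjoint, so each M^i contributes at most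
    c^T x + O(e), whence z^I <= c^T z <= k c^T x + O(e). *)

Require Import Defs.
From mathcomp Require Import all_boot all_order all_algebra.
From mathcomp Require Import all_classical all_reals all_analysis.
From mathcomp Require Import lra.

Set Implicit Arguments.
Unset Strict Implicit.
Unset Printing Implicit Defensive.

Import Order.TTheory GRing.Theory Num.Theory.
Local Open Scope ring_scope.

Lemma dotE (R : realType) (n : nat) (a x : 'cV[R]_n) :
  dot a x = \sum_j a j 0 * x j 0.
Proof. by rewrite /dot mxE; apply: eq_bigr => j _; rewrite mxE. Qed.

(** After exchanging the sums, each [j] lies in at most one of the disjoint [N X], so [f j >= 0] is
    counted at most once. *)
Lemma sum_disjoint_le (R : numDomainType) (T J : finType) (M : {set T})
    (N : T -> {set J}) (f : J -> R) :
  (forall j, 0 <= f j) ->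
  (forall X Y, X \in M -> Y \in M -> X != Y -> [disjoint N X & N Y]) ->
  \sum_(X in M) \sum_(j in N X) f j <= \sum_j f j.
Proof.
move=> f_ge0 disjN; rewrite (exchange_big_dep xpredT) //=.
apply: ler_sum => j _.
have [/existsP[X /andP[XM jX]]|noX] :=
    boolP [exists X, (X \in M) && (j \in N X)].
  rewrite (bigD1 X) ?XM //= big1 ?addr0 // => Y /andP[/andP[YM jY] YX].
  by have /disjointFr/(_ jY) := disjN _ _ YM XM YX; rewrite jX.
rewrite big_pred0 // => X; apply/negbTE; apply: contra noX => hX.
by apply/existsP; exists X.
Qed.

Section SparseClosure.
Variables (R : realType) (m n : nat).
Variables (A : 'M[rat]_(m, n)) (b : 'cV[rat]_m) (L : {set 'I_n}).

Lemma mip_hull_dot_ge (a : 'cV[R]_n) (t : R) :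
  (forall y, mip_region R A b L y -> t <= dot a y) ->
  forall y, mip_hull R A b L y -> t <= dot a y.
Proof.
move=> ha; apply: smallest_sub ha => x y k.
rewrite !inE /= => tx ty; have k0 : 0 <= k%:num by [].
have k1 : 0 <= 1 - k%:num by rewrite subr_ge0.
have -> : dot a (conv k x y) = k%:num * dot a x + (1 - k%:num) * dot a y.
  rewrite !dotE !mulr_sumr -big_split /=; apply: eq_bigr => j _.
  by rewrite !mxE mulrDr !mulrA ![a j 0 * _]mulrC.
nra.
Qed.

(** If there were no such [y], then on P the [w]-cost on [N'] would exceed that of [x] by more than
    [eps]. This is a sparse cut on [N], and [x] violates it. The slack [eps] avoids asking that a
    minimum be attained; if P is empty, the cut is vacuously valid. *)
Lemma sparse_closure_near_opt (N N' : {set 'I_n}) (w : 'I_n -> R)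
    (x : 'cV[R]_n) (eps : R) :
  N' \subset N -> sparse_closure R A b L N x -> 0 < eps ->
  exists y, mip_region R A b L y /\
    \sum_(j in N') w j * y j 0 <= \sum_(j in N') w j * x j 0 + eps.
Proof.
move=> N'N [_ cutx] eps_gt0; apply: contrapT => noy.
pose a : 'cV[R]_n := \col_j (if j \in N' then w j else 0).
have aE y : dot a y = \sum_(j in N') w j * y j 0.
  rewrite dotE [RHS]big_mkcond /=; apply: eq_bigr => j _.
  by rewrite mxE; case: ifP; rewrite ?mul0r.
have dotNa y : dot (- a) y = - dot a y.
  by rewrite !dotE -sumrN; apply: eq_bigr => j _; rewrite mxE mulNr.
suff : dot (- a) x <= - (dot a x + eps) by rewrite dotNa; lra.
apply: cutx; split=> [y hully|j jN]; last first.
  by rewrite !mxE ifN ?oppr0 //; apply: contra jN => /(fintype.subsetP N'N).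
rewrite dotNa lerN2; move: y hully; apply: mip_hull_dot_ge => y Py.
rewrite !aE; apply/ltW; rewrite ltNge; apply/negP => le_y.
by apply: noy; exists y.
Qed.

End SparseClosure.

Section MixedStableCover.
Variables (R : realType) (m n p : nat).
Variables (A : 'M[rat]_(m, n)) (b : 'cV[rat]_m) (L : {set 'I_n}).
Variables (I : 'I_p -> {set 'I_m}) (VV : {set {set 'I_p}}).

(** A common column would come from some [u] in [X] and [v] in [Y]. These differ because [X] and [Y]
    are disjoint, so they would be joined by an edge, against stability. *)
Lemma mixed_stable_node_supp_disjoint (M : {set {set 'I_p}})
    (X Y : {set 'I_p}) :
  mixed_stable (cover_graph A I) VV M -> X \in M -> Y \in M -> X != Y ->
  [disjoint node_supp A I X & node_supp A I Y].
Proof.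
case/and3P=> _ /finset.trivIsetP trivM sepM XM YM XY.
apply/pred0P => j /=; apply/negP => /andP[].
move=> /finset.bigcupP[u uX ju] /finset.bigcupP[v vY jv].
have uv : u != v.
  apply: contraTneq vY => <-.
  by have /disjointFr/(_ uX) -> := trivM _ _ XM YM XY.
move/forall_inP/(_ X XM)/forall_inP/(_ Y YM)/implyP/(_ XY): sepM.
move/forall_inP/(_ u uX)/forall_inP/(_ v vY).
by rewrite /cover_graph uv negbK => /disjointFr/(_ ju); rewrite jv.
Qed.

(** A row of block [v] with [v] in [X] has its support inside the columns of [X], so the summand
    [y X] alone satisfies it. The other summands are nonnegative, as is [A], and integrality
    survives addition. *)
Lemma glue_mip_region (k : nat) (M : 'I_k -> {set {set 'I_p}})
    (y : {set 'I_p} -> 'cV[R]_n) :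
  (forall r j, 0 <= A r j) ->
  (forall r, exists v, r \in I v) ->
  (forall v, exists i X, X \in M i /\ v \in X) ->
  (forall i X, X \in M i -> mip_region R A b L (y X)) ->
  mip_region R A b L
    (\col_j \sum_i \sum_(X in M i | j \in node_supp A I X) y X j 0).
Proof.
move=> A_ge0 Icov Mcov Py.
have y_ge0 i X j : X \in M i -> 0 <= y X j 0 by case/Py => -[].
have sum_ge0 i j (Q : pred {set 'I_p}) :
    0 <= \sum_(X in M i | Q X) y X j 0.
  by apply: sumr_ge0 => X /andP[/y_ge0].
split; last first.
  move=> j jL; rewrite mxE; apply: rpred_sum => i _; apply: rpred_sum => X.
  by case/andP=> /Py[_ /(_ j jL)].
split=> [r|j]; last by rewrite mxE; apply: sumr_ge0.
have [v rv] := Icov r; have [i [X [XM vX]]] := Mcov v.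
have [[/(_ r) + _] _] := Py _ _ XM; move/le_trans; apply.
rewrite !mxE; apply: ler_sum => j _; rewrite !mxE.
have [->|Arj] := eqVneq (A r j) 0; first by rewrite rmorph0 !mul0r.
apply: ler_wpM2l; first by rewrite ler0q.
have jX : j \in node_supp A I X.
  apply/finset.bigcupP; exists v => //; apply/finset.bigcupP; exists r => //.
  by rewrite inE.
rewrite (bigD1 i) //= (bigD1 X) ?XM //= -addrA lerDl addr_ge0 //.
  by apply: sumr_ge0 => Y /andP[/andP[/y_ge0]].
by apply: sumr_ge0.
Qed.

Lemma opt_value_hull_le (c : 'cV[rat]_n) (k : nat) (x : 'cV[R]_n) :
  (forall r j, 0 <= A r j) -> (forall j, 0 <= c j 0) ->
  (forall r, exists v, r \in I v) ->
  has_mixed_stable_cover (cover_graph A I) VV k ->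
  support_list_closure R A b L I VV x ->
  (opt_value c (mip_hull R A b L) <=
     (k%:R * dot (map_mx ratr c) x)%:E)%E.
Proof.
move=> A_ge0 c_ge0 Icov /existsP[M /andP[/forallP Mst /forallP Mcov]].
case=> -[_ x_ge0] clx; apply/lee_addgt0Pr => eps eps_gt0.
pose w j : R := ratr (c j 0).
have w_ge0 j : 0 <= w j by rewrite ler0q.
(* [T] counts the sets of all classes with multiplicity, each costing an error [d]. The successor
   keeps the denominator nonzero, and [T * d <= eps]. *)
pose T : nat := (\sum_i #|M i|)%N.
pose d := eps / T.+1%:R.
have d_gt0 : 0 < d by rewrite divr_gt0 // ltr0n.
(* The point depends on [X] only, not on the class containing it; sets in no class get the dummy
   value 0. *)
have /choice[y yP] (X : {set 'I_p}) : exists y,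
    forall i, X \in M i -> mip_region R A b L y /\
    \sum_(j in node_supp A I X) w j * y j 0 <=
    \sum_(j in node_supp A I X) w j * x j 0 + d.
  have [/existsP[i XM]|noX] := boolP [exists i, X \in M i]; last first.
    exists 0 => i XM; exfalso; apply: (negP noX).
    by apply/existsP; exists i.
  have /and3P[/forall_inP/(_ X XM)/exists_inP[S SV XS] _ _] := Mst i.
  have XSN : node_supp A I X \subset node_supp A I S.
    apply/fintype.subsetP => j /finset.bigcupP[v vX jv].
    by apply/finset.bigcupP; exists v => //; apply: (fintype.subsetP XS).
  have [y yP] := sparse_closure_near_opt w XSN (clx S SV) d_gt0.
  by exists y => ? _.
set z : 'cV[R]_n :=
  \col_j \sum_i \sum_(X in M i | j \in node_supp A I X) y X j 0.
have zP : mip_region R A b L z.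
  apply: glue_mip_region => // [v|i X XM]; last by have [] := yP X i XM.
  have /existsP[i /exists_inP[X XM vX]] := Mcov v.
  by exists i, X.
apply: ge_ereal_inf; exists (dot (map_mx ratr c) z)%:E.
  by exists z => //; apply: sub_gen_smallest.
rewrite -EFinD lee_fin.
(* Regroup the cost of [z] by class and by set. *)
have -> : dot (map_mx ratr c) z =
    \sum_i \sum_(X in M i) \sum_(j in node_supp A I X) w j * y X j 0.
  rewrite dotE; under eq_bigr do rewrite !mxE mulr_sumr.
  rewrite exchange_big /=; apply: eq_bigr => i _.
  under eq_bigr do rewrite mulr_sumr.
  rewrite (exchange_big_dep (mem (M i))) /= => [|j X _ /andP[] //].
  by apply: eq_bigr => X XM; apply: eq_bigl => j; rewrite XM.
have le_i i : \sum_(X in M i) \sum_(j in node_supp A I X) w j * y X j 0 <=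
    dot (map_mx ratr c) x + d * #|M i|%:R.
  apply: (@le_trans _ _ (\sum_(X in M i)
      (\sum_(j in node_supp A I X) w j * x j 0 + d))).
    by apply: ler_sum => X /yP[].
  rewrite big_split /= sumr_const mulr_natr lerD2r dotE.
  under [leRHS]eq_bigr do rewrite mxE.
  apply: sum_disjoint_le => [j|X Y XM YM XY]; first exact: mulr_ge0.
  exact: mixed_stable_node_supp_disjoint (Mst i) XM YM XY.
apply: le_trans (ler_sum _ (fun i _ => le_i i)) _.
rewrite big_split /= sumr_const card_ord mulr_natl lerD2l.
rewrite -mulr_sumr -natr_sum -/T /d mulrAC ler_pdivrMr ?ltr0n //.
by apply: ler_wpM2l; rewrite ?ler_nat ?(ltW eps_gt0).
Qed.

End MixedStableCover.

Theorem theorem22 (R : realType) (m n p : nat)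
    (A : 'M[rat]_(m, n)) (b : 'cV[rat]_m) (c : 'cV[rat]_n) (L : {set 'I_n})
    (A_ge0 : forall r j, 0 <= A r j)
    (b_ge0 : forall r, 0 <= b r 0)
    (c_ge0 : forall j, 0 <= c j 0)
    (I : 'I_p -> {set 'I_m})
    (I_inj : injective I)
    (I_part : finset.partition (I @: [set: 'I_p])%SET [set: 'I_m]%SET)
    (VV : {set {set 'I_p}})
    (hcov : exists k, has_mixed_stable_cover (cover_graph A I) VV k) :
  (opt_value c (support_list_closure R A b L I VV) >=
   (1 / (mixed_chromatic_number hcov)%:R)%:E *
     opt_value c (mip_hull R A b L))%E.
Proof.
rewrite /mixed_chromatic_number; case: ex_minnP => k kcov _.
have Icov r : exists v, r \in I v.
  have /and3P[/eqP Icover _ _] := I_part.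
  have : r \in finset.cover (I @: [set: 'I_p])%SET by rewrite Icover inE.
  by case/finset.bigcupP=> B /imsetP[v _ ->]; exists v.
apply: le_ereal_inf_tmp => _ [x xP <-].
have le_opt := opt_value_hull_le A_ge0 c_ge0 Icov kcov xP.
have cx_ge0 : 0 <= dot (map_mx ratr c) x.
  rewrite dotE; apply: sumr_ge0 => j _; rewrite mxE mulr_ge0 ?ler0q //.
  by have [[_]] := xP.
(* For [k = 0] the factor [1 / 0] is 0, and so is its product with a possibly infinite optimum; the
   claim becomes [0 <= c^T x]. *)
have [k0|k_gt0] := posnP k; first by rewrite k0 invr0 mulr0 mul0e lee_fin.
have k1_ge0 : (0 <= (1 / k%:R : R)%:E)%E by rewrite lee_fin divr_ge0.
apply: le_trans (lee_wpmul2l k1_ge0 le_opt) _.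
by rewrite -EFinM lee_fin mulrA div1r mulVf ?mul1r // pnatr_eq0 -lt0n.
Qed.
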